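(* If the compact hyperbolic manifold $M_\Gamma$ contains $n$ pairwise disjoint embedded totally geodesic hypersurfaces, then $\dim H^1(\Gamma,{\mathbb R}^{d,1})\ge n$.
   Context: Minkowski space ${\mathbb R}^{d,1}$ is ${\mathbb R}^{d+1}$ with $\langle x,y\rangle_{d,1}=x_1y_1+\dots+x_dy_d-x_{d+1}y_{d+1}$. $O_+(d,1)$ is the group of linear maps preserving $\langle\cdot,\cdot\rangle_{d,1}$ and the sheet $\mathcal H^d=\{\langle x,x\rangle_{d,1}=-1,\ x_{d+1}>0\}$ (a model of hyperbolic space). $d\ge2$ and $\Gamma\subset O_+(d,1)$ is a subgroup acting freely, properly discontinuously and cocompactly on $\mathcal H^d$, so that $M_\Gamma=\mathcal H^d/\Gamma$ is a compact hyperbolic manifold, assumed oriented. A cocycle is a map $\tau:\Gamma\to{\mathbb R}^{d,1}$ with $\tau(AB)=\tau(A)+A\tau(B)$ for all $A,B\in\Gamma$; a coboundary is a cocycle of the form $\tau(A)=Av-v$ for a fixed $v\in{\mathbb R}^{d,1}$, and $H^1(\Gamma,{\mathbb R}^{d,1})$ is the quotient vector space of cocycles by coboundaries. *)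

(* Defs.v *)
From mathcomp Require Import all_boot all_fingroup.
From Stdlib Require Import Reals List.
Set Implicit Arguments.
Unset Strict Implicit.
Unset Printing Implicit Defensive.

Local Open Scope R_scope.

(* Vectors of R^{d,1} = R^{d+1}; coordinate ord_max is the time coordinate x_{d+1}. *)
Definition Vec (d : nat) := 'I_d.+1 -> R.
Definition Mat (d : nat) := 'I_d.+1 -> 'I_d.+1 -> R.

Definition tcoord {d : nat} (x : Vec d) : R := x ord_max.

Definition mink {d : nat} (x y : Vec d) : R :=
  \big[Rplus/0]_(i : 'I_d.+1)
     (if i == ord_max then - (x i * y i) else x i * y i).

Definition matvec {d : nat} (A : Mat d) (x : Vec d) : Vec d :=
  fun i => \big[Rplus/0]_(j : 'I_d.+1) (A i j * x j).
Definition matmul {d : nat} (A B : Mat d) : Mat d :=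
  fun i k => \big[Rplus/0]_(j : 'I_d.+1) (A i j * B j k).
Definition idm {d : nat} : Mat d := fun i j => if i == j then 1 else 0.
Definition vadd {d : nat} (x y : Vec d) : Vec d := fun i => x i + y i.
Definition vsub {d : nat} (x y : Vec d) : Vec d := fun i => x i - y i.

Definition det {d : nat} (A : Mat d) : R :=
  \big[Rplus/0]_(s : 'S_d.+1)
     ((if odd_perm s then -1 else 1) * \big[Rmult/1]_(i : 'I_d.+1) A i (s i)).

Definition in_H {d : nat} (x : Vec d) : Prop := mink x x = -1 /\ 0 < tcoord x.

Definition in_Oplus {d : nat} (A : Mat d) : Prop :=
  (forall x y, mink (matvec A x) (matvec A y) = mink x y) /\
  (forall x, in_H x -> in_H (matvec A x)).

Definition is_subgroup_Oplus {d : nat} (Gam : Mat d -> Prop) : Prop :=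
  Gam idm /\
  (forall A B, Gam A -> Gam B -> Gam (matmul A B)) /\
  (forall A, Gam A -> exists B, Gam B /\ matmul A B = idm /\ matmul B A = idm) /\
  (forall A, Gam A -> in_Oplus A).

(* The compact sets K_r = {x in H^d | x_{d+1} <= r} exhaust H^d and every
   compact subset of H^d lies in one of them. *)
Definition in_K {d : nat} (r : R) (x : Vec d) : Prop := in_H x /\ tcoord x <= r.

Definition acts_freely {d : nat} (Gam : Mat d -> Prop) : Prop :=
  forall A x, Gam A -> in_H x -> matvec A x = x -> A = idm.

Definition acts_properly_discontinuously {d : nat} (Gam : Mat d -> Prop) : Prop :=
  forall r : R, exists l : list (Mat d),
    forall A, Gam A -> (exists x, in_K r x /\ in_K r (matvec A x)) -> In A l.

Definition acts_cocompactly {d : nat} (Gam : Mat d -> Prop) : Prop :=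
  exists r : R, forall x, in_H x -> exists A, Gam A /\ in_K r (matvec A x).

Definition orientation_preserving {d : nat} (Gam : Mat d -> Prop) : Prop :=
  forall A, Gam A -> det A = 1.

(* Standing hypotheses: M_Gamma = H^d/Gamma is a compact oriented hyperbolic manifold. *)
Definition cocompact_torsionfree_lattice {d : nat} (Gam : Mat d -> Prop) : Prop :=
  is_subgroup_Oplus Gam /\ acts_freely Gam /\ acts_properly_discontinuously Gam /\
  acts_cocompactly Gam /\ orientation_preserving Gam.

(* Totally geodesic hyperplane of H^d orthogonal to a spacelike vector v. *)
Definition onP {d : nat} (v : Vec d) (x : Vec d) : Prop := in_H x /\ mink x v = 0.

Definition in_translate {d : nat} (A : Mat d) (v : Vec d) (y : Vec d) : Prop :=
  exists x, onP v x /\ y = matvec A x.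

Definition same_translates {d : nat} (A B : Mat d) (v : Vec d) : Prop :=
  forall y, in_translate A v y <-> in_translate B v y.

(* The image of P_v in M_Gamma is a (closed) embedded totally geodesic
   hypersurface: v spacelike, each translate of P_v equals P_v or is disjoint
   from it (injectivity of P_v/Stab -> M_Gamma), and the family of translates
   is locally finite (the image is closed/properly embedded). *)
Definition embedded_tg_hypersurface {d : nat} (Gam : Mat d -> Prop) (v : Vec d) : Prop :=
  0 < mink v v /\
  (forall A, Gam A ->
     same_translates A idm v \/ ~ (exists y, in_translate A v y /\ onP v y)) /\
  (forall r : R, exists l : list (Mat d),
     (forall B, In B l -> Gam B) /\
     forall A, Gam A -> (exists y, in_translate A v y /\ in_K r y) ->
       exists B, In B l /\ same_translates A B v).

Definition disjoint_in_quotient {d : nat} (Gam : Mat d -> Prop) (v w : Vec d) : Prop :=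
  forall A, Gam A -> ~ (exists y, in_translate A v y /\ onP w y).

Definition is_cocycle {d : nat} (Gam : Mat d -> Prop) (tau : Mat d -> Vec d) : Prop :=
  forall A B, Gam A -> Gam B -> tau (matmul A B) = vadd (tau A) (matvec A (tau B)).

Definition is_coboundary {d : nat} (Gam : Mat d -> Prop) (tau : Mat d -> Vec d) : Prop :=
  exists v : Vec d, forall A, Gam A -> tau A = vsub (matvec A v) v.

(* dim H^1(Gamma, R^{d,1}) >= n : there are n cocycles whose classes are
   linearly independent in cocycles/coboundaries. *)
Definition dimH1_ge {d : nat} (Gam : Mat d -> Prop) (n : nat) : Prop :=
  exists taus : 'I_n -> Mat d -> Vec d,
    (forall k, is_cocycle Gam (taus k)) /\
    forall c : 'I_n -> R,
      is_coboundary Gam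
        (fun A i => \big[Rplus/0]_(k : 'I_n) (c k * taus k A i)) ->
      forall k, c k = 0.

(* Main.v *)
(* For each hypersurface let N k be the set of all normals +-A (v k), A in
   Gam.  Summing the normals of the walls crossed by a path from the origin e
   to x, each oriented in the direction of the crossing, gives a vector
   wall_sum k x, and A |-> wall_sum k (A e) is a cocycle.  Suppose that a
   combination with weights c k is the coboundary of u.  Then
   potential x = u + \sum_k c k * wall_sum k x is Gam-equivariant and locally
   constant off the walls, so h x = <potential x, x> is Gam-invariant, and
   homogeneous of degree 1 when extended to the open future cone; cocompactness
   therefore bounds |h x| by a multiple of the Lorentz norm of x.

   Walls do not cross, so potential is constant along a wall; there h is linear
   and bounded by a function vanishing at the light cone, which forces h = 0 on
   the walls (this needs a tangent direction, hence d >= 2).  Leaving a wall at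
   x in the direction of its normal m, h (x + s m) equals
   s (<potential x, m> + 2 c k <m, m>) until the next wall, or the light cone,
   is reached, and h vanishes there; so the bracket is 0.  Adding the same
   identity for the normal - m gives c k = 0. *)
Require Import Defs.
From mathcomp Require Import all_boot all_fingroup.
From Stdlib Require Import Reals List.
From mathcomp Require Import all_order all_algebra.
From mathcomp Require Import finmap boolp classical_sets functions cardinality fsbigop.
From mathcomp Require Import Rstruct ring lra.
Set Implicit Arguments.
Unset Strict Implicit.
Unset Printing Implicit Defensive.
Import Order.TTheory GRing.Theory Num.Theory.
(* Reals rebinds the key N to the scope of binary naturals. *)
Delimit Scope nat_scope with N.
Local Open Scope ring_scope.
Local Notation R := Rdefinitions.R.

Definition vscale {d : nat} (a : R) (x : Vec d) : Vec d := fun i => a * x i.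
Arguments vscale {d} a%_ring_scope x.
Definition origin (d : nat) : Vec d := fun i => (i == ord_max)%:R.
Arguments origin : clear implicits.

Section Minkowski.
Variable d : nat.
Implicit Types (x y z v w : Vec d) (A B : Mat d) (a b s : R).

Lemma vaddE x y i : vadd x y i = x i + y i.
Proof. by []. Qed.

Lemma vscaleE a x i : vscale a x i = a * x i.
Proof. by []. Qed.

Lemma minkE x y :
  mink x y = \sum_i (if i == ord_max then - (x i * y i) else x i * y i).
Proof. by []. Qed.

Lemma minkC x y : mink x y = mink y x.
Proof. by rewrite !minkE; apply: eq_bigr => i _; rewrite mulrC. Qed.

Lemma minkDl x y z : mink (vadd x y) z = mink x z + mink y z.
Proof.
rewrite !minkE -big_split; apply: eq_bigr => i _ /=.
rewrite vaddE; case: eqP => _; ring.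
Qed.

Lemma minkZl a x z : mink (vscale a x) z = a * mink x z.
Proof.
rewrite !minkE mulr_sumr; apply: eq_bigr => i _ /=.
rewrite /vscale; case: eqP => _; ring.
Qed.

Lemma minkDr x y z : mink z (vadd x y) = mink z x + mink z y.
Proof. by rewrite minkC minkDl !(minkC z). Qed.

Lemma minkZr a x z : mink z (vscale a x) = a * mink z x.
Proof. by rewrite minkC minkZl (minkC z). Qed.

Definition mink_lin := (minkDl, minkDr, minkZl, minkZr).

Let sp x y := \sum_(i | i != ord_max) x i * y i.

Let mink_sp x y : mink x y = sp x y - x ord_max * y ord_max.
Proof.
rewrite minkE (bigD1 ord_max) //= eqxx addrC; congr (_ - _).
by apply: eq_bigr => i /negbTE ->.
Qed.

Let sp_ge0 x : 0 <= sp x x.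
Proof. by apply: sumr_ge0 => i _; rewrite -expr2 sqr_ge0. Qed.

Let sp_eq0 x : sp x x <= 0 -> forall i, i != ord_max -> x i = 0.
Proof.
move=> h i hi; have {}h : sp x x = 0 by apply/eqP; rewrite eq_le h sp_ge0.
have := psumr_eq0P _ h hi; rewrite -expr2 => h2; apply/eqP.
by rewrite -sqrf_eq0 h2 // => j _; rewrite -expr2 sqr_ge0.
Qed.

Let sp_CS x y : sp x y ^+ 2 <= sp x x * sp y y.
Proof.
have [h|h] := leP (sp y y) 0.
  have -> : sp x y = 0 by apply: big1 => i /(sp_eq0 h) ->; rewrite mulr0.
  by rewrite expr0n mulr_ge0 ?sp_ge0.
suff : 0 <= sp y y * (sp x x * sp y y - sp x y ^+ 2).
  by rewrite pmulr_rge0 // subr_ge0.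
have sq s t : \sum_(i | i != ord_max) (s * x i - t * y i) ^+ 2 =
    s ^+ 2 * sp x x - 2 * s * t * sp x y + t ^+ 2 * sp y y.
  by rewrite !mulr_sumr -sumrB -big_split /=; apply: eq_bigr => i _; ring.
have -> : sp y y * (sp x x * sp y y - sp x y ^+ 2) =
    \sum_(i | i != ord_max) (sp y y * x i - sp x y * y i) ^+ 2.
  by rewrite sq; ring.
by apply: sumr_ge0 => i _; rewrite sqr_ge0.
Qed.

Definition cone x : Prop := mink x x < 0 /\ 0 < x ord_max.

Lemma in_HP x : in_H x <-> mink x x = -1 /\ 0 < x ord_max.
Proof.
rewrite /in_H /tcoord; split => -[h1 h2]; split.
- by rewrite h1.
- exact/RltP.
- by rewrite h1.
- exact/RltP.
Qed.

Lemma in_H_cone x : in_H x -> cone x.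
Proof. by case/in_HP => h1 h2; split; rewrite ?h1 ?ltrN10. Qed.

Lemma cone_mink_lt0 x y : cone x -> cone y -> mink x y < 0.
Proof.
rewrite /cone !mink_sp => -[hx tx] [hy ty].
have := sp_CS x y; have := sp_ge0 x; have := sp_ge0 y.
move: (sp x y) (sp x x) (sp y y) (x ord_max) (y ord_max) hx tx hy ty.
move=> c p q s t hp hs hq ht q0 p0 cs.
rewrite subr_lt0 ltNge; apply/negP => hc.
have h1 : (s * t) ^+ 2 <= c ^+ 2.
  have h0 : 0 <= s * t by rewrite mulr_ge0 ?ltW.
  by rewrite ler_pXn2r // nnegrE (le_trans h0 hc).
have h2 : p * q < (s * t) ^+ 2.
  have -> : (s * t) ^+ 2 = (s * s) * (t * t) by ring.
  by apply: ltr_pM => //; rewrite -subr_lt0.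
by have := lt_le_trans h2 (le_trans h1 cs); rewrite ltxx.
Qed.

Lemma coneD x y : cone x -> cone y -> cone (vadd x y).
Proof.
move=> hx hy; have hxy := cone_mink_lt0 hx hy.
case: hx hy => [hx tx] [hy ty]; split; last exact: addr_gt0.
rewrite !mink_lin (minkC y x); lra.
Qed.

Lemma coneZ a x : 0 < a -> cone x -> cone (vscale a x).
Proof.
move=> a0 [h t]; split; last exact: mulr_gt0.
by rewrite !mink_lin !pmulr_rlt0.
Qed.

Lemma vscale1 x : vscale 1 x = x.
Proof. by apply/funext => i; rewrite /vscale mul1r. Qed.

Lemma cone_convex s x y : 0 <= s <= 1 -> cone x -> cone y ->
  cone (vadd (vscale (1 - s) x) (vscale s y)).
Proof.
move=> /andP[s0 s1] hx hy.
have [e|n0] := eqVneq s 0.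
  suff -> : vadd (vscale (1 - s) x) (vscale s y) = x by [].
  by apply/funext => i; rewrite vaddE !vscaleE e subr0 mul1r mul0r addr0.
have [e|n1] := eqVneq s 1.
  suff -> : vadd (vscale (1 - s) x) (vscale s y) = y by [].
  by apply/funext => i; rewrite vaddE !vscaleE e subrr mul1r mul0r add0r.
by apply: coneD; apply: coneZ => //; rewrite ?subr_gt0 lt_neqAle ?s1 ?s0 ?n1 // eq_sym n0.
Qed.

Lemma cone_normalize x : cone x -> exists2 a, 0 < a & in_H (vscale a x).
Proof.
move=> [h t]; have h0 : 0 < - mink x x by rewrite oppr_gt0.
exists (Num.sqrt (- mink x x))^-1; first by rewrite invr_gt0 sqrtr_gt0.
apply/in_HP; split; last by rewrite mulr_gt0 // invr_gt0 sqrtr_gt0.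
rewrite !mink_lin mulrA -expr2 exprVn sqr_sqrtr ?ltW //.
by rewrite invrN mulNr mulVf // lt_eqF.
Qed.

Lemma mink_orth_cone_gt0 x w :
  cone x -> mink w x = 0 -> (exists i, w i != 0) -> 0 < mink w w.
Proof.
move=> [hx tx]; rewrite !mink_sp => /subr0_eq hw [i wi].
move: hx; rewrite mink_sp subr_lt0 => hx.
rewrite subr_gt0 ltNge; apply/negP => hle.
have := sp_CS w x; rewrite hw => cs.
have wt0 : w ord_max = 0.
  apply/eqP/negPn/negP => wt.
  have wt2 : 0 < w ord_max * w ord_max by rewrite -expr2 exprn_even_gt0.
  have : (w ord_max * x ord_max) ^+ 2 <= (w ord_max * w ord_max) * sp x x.
    by apply: le_trans cs _; apply: ler_wpM2r.
  rewrite leNgt; apply/negP/negPn.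
  have -> : (w ord_max * x ord_max) ^+ 2 =
    (w ord_max * w ord_max) * (x ord_max * x ord_max) by ring.
  by rewrite ltr_pM2l.
move: wi; have [-> /eqP //|hi] := eqVneq i ord_max.
by rewrite (sp_eq0 _ hi) ?eqxx // (le_trans hle) // wt0 mulr0.
Qed.

Lemma cone_of_mink_lt0 x y : cone x -> mink y y < 0 -> mink y x < 0 -> cone y.
Proof.
move=> hx yy yx; split=> //; rewrite ltNge; apply/negP => yt.
have yt0 : y ord_max != 0.
  apply/eqP => yt0; move: yy; rewrite mink_sp yt0 mulr0 subr0.
  by rewrite ltNge sp_ge0.
have : cone (vscale (-1) y).
  split; first by rewrite !mink_lin !mulN1r opprK.
  by rewrite vscaleE mulN1r oppr_gt0 lt_neqAle yt0.
by move=> /cone_mink_lt0 /(_ hx); rewrite minkZl mulN1r oppr_lt0 ltNge (ltW yx).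
Qed.

Lemma norm_coord_in_H x i : in_H x -> `|x i| <= x ord_max.
Proof.
case/in_HP; rewrite mink_sp => h t.
have [->|hi] := eqVneq i ord_max; first by rewrite gtr0_norm.
rewrite -(ler_pXn2r (n := 2)) ?nnegrE ?normr_ge0 ?(ltW t) // real_normK ?num_real //.
have : x i ^+ 2 <= sp x x.
  rewrite /sp (bigD1 i) //= expr2 lerDl; apply: sumr_ge0 => j _.
  by rewrite -expr2 sqr_ge0.
move=> hs; apply: le_trans hs _; rewrite expr2; lra.
Qed.

Lemma tcoord_in_H_ge1 x : in_H x -> 1 <= x ord_max.
Proof.
case/in_HP; rewrite mink_sp => h t; have := sp_ge0 x => h0.
rewrite -(ler_pXn2r (n := 2)) ?nnegrE ?(ltW t) // expr1n expr2; lra.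
Qed.

Definition coordv (i : 'I_d.+1) : Vec d := fun j => (j == i)%:R.

Lemma mink_coordv i x : mink (coordv i) x = if i == ord_max then - x i else x i.
Proof.
rewrite minkE (bigD1 i) //= big1 ?addr0 => [|j hj]; rewrite /coordv.
  by rewrite eqxx mul1r.
by rewrite (negbTE hj) mul0r oppr0 if_same.
Qed.

Lemma mink_origin x : mink (origin d) x = - x ord_max.
Proof. by rewrite -[origin d]/(coordv ord_max) mink_coordv eqxx. Qed.

Lemma origin_max : origin d ord_max = 1.
Proof. by rewrite /origin eqxx. Qed.

Lemma origin_in_H : in_H (origin d).
Proof. by apply/in_HP; rewrite mink_origin origin_max ltr01. Qed.

Lemma mink_nondegenerate x : (forall z, mink z x = 0) -> forall i, x i = 0.
Proof.
move=> h i; have := h (coordv i); rewrite mink_coordv.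
by case: eqP => // _ /eqP; rewrite oppr_eq0 => /eqP.
Qed.

End Minkowski.

Section Hyperplanes.
Variable d : nat.
Implicit Types (x y z v w n m : Vec d) (A B : Mat d) (a b s : R).

Lemma plane_nonempty v : 0 < mink v v -> exists x, onP v x.
Proof.
move=> hv; set x := vadd (origin d) (vscale (v ord_max / mink v v) v).
have v0 : mink v v != 0 by rewrite gt_eqF.
have hx : cone x.
  split; rewrite /x.
    rewrite !mink_lin mink_origin (minkC v) mink_origin origin_max.
    set q := mink v v in hv v0 *; set t := v ord_max.
    rewrite [X in X < 0](_ : _ = - (1 + t ^+ 2 / q)); last by field.
    by rewrite oppr_lt0 ltr_wpDr ?divr_ge0 ?sqr_ge0 ?(ltW hv).
  rewrite vaddE vscaleE origin_max -mulrA [_^-1 * _]mulrC mulrA -expr2.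
  by rewrite ltr_wpDr ?divr_ge0 ?sqr_ge0 ?(ltW hv).
have [a a0 ha] := cone_normalize hx.
exists (vscale a x); split => //.
rewrite /x !mink_lin mink_origin divfK // addNr mulr0 //.
Qed.

Lemma plane_orthogonal v w : 0 < mink v v ->
  (forall y, onP v y -> mink y w = 0) -> forall z, mink z v = 0 -> mink z w = 0.
Proof.
move=> hv hw z zv; have [x [xH xv]] := plane_nonempty hv.
have xw : mink x w = 0 by apply: hw; split.
have [xx xt] := (in_HP x).1 xH; have t1 := tcoord_in_H_ge1 xH.
pose a := 1 + `|z ord_max| + 2 * `|mink x z| + `|mink z z|.
have a1 : 1 <= a by rewrite /a -!addrA lerDl !addr_ge0 ?mulr_ge0 // ?ler0n.
have hc : cone (vadd (vscale a x) z).
  split.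
    rewrite !mink_lin (minkC z x) xx.
    have := ler_norm (mink x z); have := ler_norm (mink z z).
    move: a1; rewrite /a.
    have := normr_ge0 (z ord_max); have := normr_ge0 (mink x z).
    have := normr_ge0 (mink z z).
    move: `|z ord_max| `|mink x z| `|mink z z| (mink x z) (mink z z) => t b c b' c'.
    move=> c0 b0 t0 h1 hc hb.
    nra.
  rewrite vaddE vscaleE.
  have : - z ord_max <= `|z ord_max| by rewrite -normrN ler_norm.
  have : 1 + `|z ord_max| <= a.
    by rewrite /a -[leRHS]addrA lerDl !addr_ge0 ?mulr_ge0 // ?ler0n.
  move: `|_| => t; nra.
have [b b0 hb] := cone_normalize hc.
have := hw (vscale b (vadd (vscale a x) z)).
rewrite /onP !mink_lin xv zv mulr0 addr0 mulr0 xw mulr0 add0r.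
by move=> /(_ (conj hb erefl)) /eqP; rewrite mulf_eq0 gt_eqF //= => /eqP.
Qed.

Lemma same_plane_normal v w : 0 < mink v v -> mink v v = mink w w ->
  (forall y, onP v y -> mink y w = 0) -> w = v \/ w = vscale (-1) v.
Proof.
move=> hv hvw /(plane_orthogonal hv) h.
have v0 : mink v v != 0 by rewrite gt_eqF.
pose l := mink w v / mink v v.
have wl : w = vscale l v.
  apply/funext => i; apply/eqP; rewrite -subr_eq0 -mulN1r; apply/eqP.
  apply: (mink_nondegenerate (x := vadd w (vscale (-1) (vscale l v)))) => {i} z.
  rewrite !mink_lin.
  have := h (vadd z (vscale (- (mink z v / mink v v)) v)).
  rewrite !mink_lin (minkC v w) /l => hz.
  have := hz _; rewrite mulNr divfK // subrr => /(_ erefl) {hz} hz.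
  rewrite -[RHS]hz; field. done.
have /eqP : l ^+ 2 = 1.
  by have := hvw; rewrite wl !mink_lin mulrA -expr2 -{1}[mink v v]mul1r => /(mulIf v0) <-.
by rewrite sqrf_eq1 => /orP[]/eqP hl; [left|right]; rewrite wl hl // vscale1.
Qed.

Lemma plane_tangent x v : (2 <= d)%N -> in_H x -> 0 < mink v v -> mink x v = 0 ->
  exists w, [/\ mink w x = 0, mink w v = 0 & 0 < mink w w].
Proof.
move=> d2 xH hv xv; have v0 : mink v v != 0 by rewrite gt_eqF.
have [xx _] := (in_HP x).1 xH.
pose p i := vadd (coordv i) (vadd (vscale (mink (coordv i) x) x)
   (vscale (- (mink (coordv i) v / mink v v)) v)).
have px i : mink (p i) x = 0.
  by rewrite /p !mink_lin xx (minkC v x) xv; ring.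
have pv i : mink (p i) v = 0.
  by rewrite /p !mink_lin xv; field.
have [[i [j pij]]|h] := pselect (exists i j, p i j != 0).
  exists (p i); split => //.
  by apply: (mink_orth_cone_gt0 (in_H_cone xH)) => //; exists j.
have [k dk] : exists k, d = k.+2 by exists d.-2; case: (d) d2 => [|[]].
suff : \sum_i p i i = k.+1%:R.
  rewrite big1 => [/esym/eqP|i _]; first by rewrite pnatr_eq0.
  by apply/eqP/negPn/negP => pii; apply: h; exists i, i.
rewrite /p; under eq_bigr => i _ do rewrite !vaddE !vscaleE.
rewrite !big_split /=.
have -> : \sum_(i < d.+1) coordv i i = k.+3%:R.
  rewrite (eq_bigr (fun=> 1)) => [|i _]; last by rewrite /coordv eqxx.
  by rewrite sumr_const card_ord dk.
have e y : \sum_i mink (coordv i) y * y i = mink y y.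
  rewrite minkE; apply: eq_bigr => i _; rewrite mink_coordv.
  by case: ifP; rewrite ?mulNr.
have -> : \sum_i - (mink (coordv i) v / mink v v) * v i = -1.
  under eq_bigr => i _ do rewrite mulNr mulrAC -mulNr.
  by rewrite -mulr_suml sumrN e mulNr divff.
by rewrite e xx -(natr1 k.+2) -(natr1 k.+1); ring.
Qed.

End Hyperplanes.

Section LinearAction.
Variable d : nat.
Implicit Types (x y z v w n m : Vec d) (A B : Mat d) (a b s : R).

Lemma matvecE A x i : matvec A x i = \sum_j A i j * x j.
Proof. by []. Qed.

Lemma matvecZ A a x : matvec A (vscale a x) = vscale a (matvec A x).
Proof.
apply/funext => i; rewrite vscaleE !matvecE mulr_sumr; apply: eq_bigr => j _ /=.
by rewrite vscaleE mulrCA.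
Qed.

Lemma matvecM A B x : matvec (matmul A B) x = matvec A (matvec B x).
Proof.
apply/funext => i; rewrite !matvecE.
under [RHS]eq_bigr => j _ do rewrite matvecE mulr_sumr.
rewrite exchange_big; apply: eq_bigr => k _.
rewrite -[matmul A B i k]/(\sum_j A i j * B j k) mulr_suml.
by apply: eq_bigr => j _; rewrite mulrA.
Qed.

Lemma matvec1 x : matvec Defs.idm x = x.
Proof.
apply/funext => i; rewrite matvecE (bigD1 i) //= big1 => [|j ji]; rewrite /Defs.idm.
  by rewrite eqxx addr0 mul1r.
by rewrite eq_sym (negbTE ji) mul0r.
Qed.

Lemma Oplus_cone A x : in_Oplus A -> cone x -> cone (matvec A x).
Proof.
move=> [_ hA] hx; have [a a0 ha] := cone_normalize hx.
suff -> : matvec A x = vscale a^-1 (matvec A (vscale a x)).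
  by apply: coneZ; [rewrite invr_gt0|exact/in_H_cone/hA].
apply/funext => i; rewrite matvecZ !vscaleE mulrA mulVf ?mul1r //.
by rewrite gt_eqF.
Qed.

End LinearAction.

Lemma sgr_neq_segment (a b : R) : Num.sg a != Num.sg b ->
  exists2 s, 0 <= s <= 1 & (1 - s) * a + s * b = 0.
Proof.
move=> h; have ab : a - b != 0.
  by apply: contraNneq h => /subr0_eq ->.
exists (a / (a - b)); last by field.
have [a0|a0|a0] := ltgtP a 0; have [b0|b0|b0] := ltgtP b 0.
all: move: h; rewrite ?(ltr0_sg a0) ?(ltr0_sg b0) ?(gtr0_sg a0) ?(gtr0_sg b0)
  ?a0 ?b0 ?sgr0 ?eqxx //= => _.
- have ab0 : a - b < 0 by lra.
  by rewrite ler_ndivlMr // ler_ndivrMr // mul0r mul1r (ltW a0) /=; lra.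
- by rewrite subr0 divff ?ler01 ?lexx // lt_eqF.
- have ab0 : 0 < a - b by lra.
  by rewrite ler_pdivlMr // ler_pdivrMr // mul0r mul1r (ltW a0) /=; lra.
- by rewrite subr0 divff ?ler01 ?lexx // gt_eqF.
- by rewrite mul0r lexx ler01.
- by rewrite mul0r lexx ler01.
Qed.

Lemma le0_of_linear_bound (X K : R) :
  (forall e, 0 < e <= 1 -> X <= K * e) -> X <= 0.
Proof.
move=> h; rewrite leNgt; apply/negP => X0.
have XK : X <= K by rewrite -[K]mulr1; apply: h; rewrite ltr01 lexx.
have K0 : 0 < K := lt_le_trans X0 XK.
have := h (X / (2 * K)); rewrite [K * _](_ : _ = X / 2); last first.
  by field; rewrite gt_eqF.
have -> : 0 < X / (2 * K) <= 1.
  by rewrite divr_gt0 ?mulr_gt0 //= ler_pdivrMr ?mulr_gt0 //; lra.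
by move=> /(_ isT); lra.
Qed.

(* Averaging the bound over s and - s removes b from the left-hand side, and
   the right-hand side tends to 0 as s ^+ 2 * q tends to 1. *)
Lemma affine_lightcone_bound (M q a b : R) : 0 < q -> 0 <= M ->
  (forall s, s ^+ 2 * q < 1 -> (a + s * b) ^+ 2 <= M * (1 - s ^+ 2 * q)) ->
  a = 0.
Proof.
move=> q0 M0 h; apply/eqP; rewrite -sqrf_eq0 eq_le sqr_ge0 andbT.
apply: (@le0_of_linear_bound _ M) => e /andP[e0 e1].
pose s := Num.sqrt ((1 - e) / q).
have s2 : s ^+ 2 * q = 1 - e.
  by rewrite sqr_sqrtr ?divfK ?divr_ge0 ?gt_eqF ?subr_ge0 ?(ltW q0).
have := h s; have := h (- s); rewrite sqrrN s2.
have -> : 1 - e < 1 by rewrite gtrBl.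
move=> /(_ isT) h1 /(_ isT) h2.
have := sqr_ge0 (s * b); rewrite !expr2 in h1 h2 *; nra.
Qed.

Lemma linear_lightcone_bound (M q b : R) : 0 < q -> 0 <= M ->
  (forall s, 0 < s -> s ^+ 2 * q < 1 -> (s * b) ^+ 2 <= M * (1 - s ^+ 2 * q)) ->
  b = 0.
Proof.
move=> q0 M0 h; apply/eqP; rewrite -sqrf_eq0 eq_le sqr_ge0 andbT.
rewrite -(pmulr_lle0 _ (_ : 0 < q^-1)) ?invr_gt0 //.
pose K := M + b ^+ 2 / q.
apply: (@le0_of_linear_bound _ K) => e /andP[e0].
have bq : 0 <= b ^+ 2 / q by rewrite divr_ge0 ?sqr_ge0 ?ltW.
rewrite le_eqVlt => /orP[/eqP->|e1]; first by rewrite mulr1 lerDr.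
rewrite {}/K.
pose s := Num.sqrt ((1 - e) / q).
have s2 : s ^+ 2 = (1 - e) / q.
  by rewrite sqr_sqrtr // divr_ge0 ?subr_ge0 ?(ltW q0) ?(ltW e1).
have := h s; rewrite exprMn s2 divfK ?gt_eqF //.
have -> : 1 - e < 1 by rewrite gtrBl.
have -> : 0 < s by rewrite sqrtr_gt0 divr_gt0 // subr_gt0.
move=> /(_ isT isT).
rewrite [(1 - e) / q * _](_ : _ = b ^+ 2 / q - e * (b ^+ 2 / q)); last first.
  by field; rewrite gt_eqF.
rewrite subKr mulrDl -lerBlDr; apply: le_trans; rewrite le_eqVlt.
by apply/orP; left; apply/eqP; ring.
Qed.

Lemma finite_set_min (S : set R) (t : R) : finite_set S -> S t ->
  exists2 s, S s & forall r, S r -> s <= r.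
Proof.
move=> /finite_seqP[l ->]; rewrite /mkset; elim: l t => [//|a l ih] t _ /=.
have [->|/eqP] := pselect (l = [::]).
  by exists a; rewrite ?mem_head // => r; rewrite inE => /eqP ->.
rewrite -size_eq0 -lt0n; case: l ih => [//|b l] ih _.
have [s sl hs] := ih b (mem_head _ _).
have [as_|sa] := leP a s.
  exists a; rewrite ?mem_head // => r; rewrite inE => /orP[/eqP -> //|/hs].
  exact: le_trans.
exists s; first by rewrite inE sl orbT.
by move=> r; rewrite inE => /orP[/eqP ->|/hs //]; exact: ltW.
Qed.

Section FiniteSums.
Variable T : choiceType.

Lemma fsum_restrict (P : set T) (D : set T) (f g : T -> R) : finite_set D ->
  (D `<=` P)%classic -> (forall m, P m -> ~ D m -> f m = 0) ->
  \sum_(m \in P) f m * g m = \sum_(m <- fset_set D) f m * g m.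
Proof.
move=> finD DP f0; rewrite -(fsbig_finite _ _ finD); symmetry.
by apply: fsbig_widen => // m [Pm Dm]; rewrite /= f0 ?mul0r.
Qed.

Lemma fsumB (P D1 D2 : set T) (f1 f2 g : T -> R) :
  finite_set D1 -> finite_set D2 -> (D1 `<=` P)%classic -> (D2 `<=` P)%classic ->
  (forall m, P m -> ~ D1 m -> f1 m = 0) -> (forall m, P m -> ~ D2 m -> f2 m = 0) ->
  \sum_(m \in P) f1 m * g m - \sum_(m \in P) f2 m * g m =
  \sum_(m \in P) (f1 m - f2 m) * g m.
Proof.
move=> F1 F2 S1 S2 Z1 Z2; pose D := (D1 `|` D2)%classic.
have FD : finite_set D by rewrite finite_setU.
have SD : (D `<=` P)%classic by move=> m [/S1|/S2].
have Z1' m : P m -> ~ D m -> f1 m = 0.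
  by move=> Pm Dm; apply: Z1 => // h; apply: Dm; left.
have Z2' m : P m -> ~ D m -> f2 m = 0.
  by move=> Pm Dm; apply: Z2 => // h; apply: Dm; right.
rewrite !(fsum_restrict _ FD SD) //; last by move=> m Pm Dm; rewrite Z1' ?Z2' ?subrr.
by rewrite -sumrB; apply: eq_bigr => m _; rewrite mulrBl.
Qed.

End FiniteSums.

Section Walls.
Variables (d n : nat) (Gam : Mat d -> Prop) (N : 'I_n -> set (Vec d)).
Hypothesis Gam_group : is_subgroup_Oplus Gam.
Hypothesis N_inv : forall k A m, Gam A -> N k m -> N k (matvec A m).
Hypothesis N_finite : forall k r,
  finite_set [set m | N k m /\ exists y, [/\ in_H y, y ord_max <= r & mink y m = 0]].
Implicit Types (x y z w m : Vec d) (A B : Mat d) (k : 'I_n).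

Let Oplus A : Gam A -> in_Oplus A.
Proof. by case: Gam_group => _ [_ [_]]; apply. Qed.

Definition side x m : R := Num.sg (mink x m) - Num.sg (mink (origin d) m).

Lemma sideZ a x m : 0 < a -> side (vscale a x) m = side x m.
Proof. by move=> a0; rewrite /side minkZl sgrM gtr0_sg // mul1r. Qed.

Lemma side_neq0_meets x r m : in_H x -> x ord_max <= r -> side x m != 0 ->
  exists y, [/\ in_H y, y ord_max <= r & mink y m = 0].
Proof.
move=> xH xr; rewrite subr_eq0 eq_sym => /sgr_neq_segment[s s01 hs].
have [xx xt] := (in_HP x).1 xH; have t1 := tcoord_in_H_ge1 xH.
pose z := vadd (vscale (1 - s) (origin d)) (vscale s x).
have zc : cone z by apply: cone_convex => //; apply: in_H_cone => //; exact: origin_in_H.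
have [a a0 aH] := cone_normalize zc; have [az _] := (in_HP _).1 aH.
case/andP: s01 => s0 s1.
have zz : mink z z <= -1.
  rewrite /z !mink_lin xx (minkC x) !mink_origin origin_max.
  have := mulr_ge0 (mulr_ge0 s0 (_ : 0 <= 1 - s)) (_ : 0 <= x ord_max - 1).
  rewrite !subr_ge0 => /(_ s1 t1).
  move: (x ord_max) => t; nra.
have a1 : a <= 1.
  rewrite leNgt; apply/negP => a1; move: az; rewrite minkZl minkZr mulrA.
  have a2 : 1 < a * a by nra.
  have : a * a * mink z z < -1 by nra.
  by move=> + e; rewrite e ltxx.
exists (vscale a z); split => //; last by rewrite /z !mink_lin hs mulr0.
apply: le_trans xr; rewrite vscaleE.
have zx : z ord_max <= x ord_max.
  by rewrite /z vaddE !vscaleE origin_max; nra.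
by case: zc => _ zt; nra.
Qed.

Lemma finite_side k x : cone x -> finite_set (N k `&` [set m | side x m != 0])%classic.
Proof.
move=> xc; have [a a0 aH] := cone_normalize xc.
apply: sub_finite_set (N_finite k (vscale a x ord_max)) => m [Nm hm]; split => //.
by apply: (side_neq0_meets aH) => //; rewrite sideZ.
Qed.

(* Every hyperplane contributes twice, once for each of its two normals. *)
Definition wall_sum k x : Vec d := fun i => \sum_(m \in N k) side x m * m i.

Lemma wall_sumZ k a x : 0 < a -> wall_sum k (vscale a x) = wall_sum k x.
Proof.
move=> a0; apply/funext => i; apply: eq_fsbigr => m _; rewrite sideZ //.
Qed.

Lemma wall_sum_linear k x (l : 'I_d.+1 -> R) : cone x ->
  \sum_i l i * wall_sum k x i = \sum_(m \in N k) side x m * \sum_i l i * m i.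
Proof.
move=> /(finite_side k); set D := (_ `&` _)%classic => finD.
have DN : (D `<=` N k)%classic by move=> m [].
have Z m : N k m -> ~ D m -> side x m = 0.
  by move=> Nm Dm; apply/eqP/negPn/negP => h; apply: Dm.
rewrite (fsum_restrict _ finD) //.
under eq_bigr => i _ do rewrite /wall_sum (fsum_restrict _ finD DN Z) mulr_sumr.
rewrite exchange_big; apply: eq_bigr => m _; rewrite mulr_sumr.
by apply: eq_bigr => i _; rewrite mulrCA.
Qed.

Lemma mink_wall_sum k x y : cone x ->
  mink (wall_sum k x) y = \sum_(m \in N k) side x m * mink m y.
Proof.
move=> xc; have e z : mink z y = \sum_i (if i == ord_max then - y i else y i) * z i.
  rewrite minkE; apply: eq_bigr => i _.
  by case: ifP; rewrite ?mulNr (mulrC (y i)).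
rewrite e wall_sum_linear //; apply: eq_fsbigr => m _; by rewrite e.
Qed.

Lemma side_sum_sub k x y (g : Vec d -> R) : cone x -> cone y ->
  \sum_(m \in N k) side x m * g m - \sum_(m \in N k) side y m * g m =
  \sum_(m \in N k) (Num.sg (mink x m) - Num.sg (mink y m)) * g m.
Proof.
move=> /(finite_side k) F1 /(finite_side k) F2; rewrite (fsumB _ F1 F2).
- by apply: eq_fsbigr => m _; rewrite /side opprB addrA subrK.
- by move=> m [].
- by move=> m [].
- by move=> m Nm Dm; apply/eqP/negPn/negP => h; apply: Dm.
- by move=> m Nm Dm; apply/eqP/negPn/negP => h; apply: Dm.
Qed.

Lemma N_bij k A : Gam A -> set_bij (N k) (N k) (matvec A).
Proof.
move=> gA; have [_ [_ [inv _]]] := Gam_group; have [B [gB [AB BA]]] := inv A gA.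
split.
- by move=> m; exact: N_inv.
- move=> x y _ _ /(congr1 (matvec B)).
  by rewrite -!matvecM BA !matvec1.
- move=> m Nm; exists (matvec B m); first exact: N_inv.
  by rewrite -matvecM AB matvec1.
Qed.

Lemma wall_sum_equivariant k A x : Gam A -> cone x ->
  wall_sum k (matvec A x) =
  vadd (wall_sum k (matvec A (origin d))) (matvec A (wall_sum k x)).
Proof.
move=> gA xc; have oA := Oplus gA; have oc := in_H_cone (origin_in_H d).
apply/funext => i; rewrite vaddE; apply/eqP; rewrite addrC -subr_eq; apply/eqP.
rewrite /wall_sum (side_sum_sub _ (fun m => m i)); try exact: Oplus_cone.
rewrite (reindex_fsbig (matvec A) (N k) (N k)) /=; last exact: N_bij.
rewrite matvecE wall_sum_linear //; apply: eq_fsbigr => m _.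
by rewrite !oA.1.
Qed.

Lemma wall_sum_cocycle k : is_cocycle Gam (fun A => wall_sum k (matvec A (origin d))).
Proof.
move=> A B gA gB; rewrite matvecM wall_sum_equivariant //.
by apply: Oplus_cone; [exact: Oplus|exact: in_H_cone (origin_in_H d)].
Qed.

Variables (c : 'I_n -> R) (u : Vec d).
Hypothesis c_coboundary : forall A i, Gam A ->
  \sum_k c k * wall_sum k (matvec A (origin d)) i = matvec A u i - u i.

Definition potential x : Vec d := fun i => u i + \sum_k c k * wall_sum k x i.

Lemma potentialZ a x : 0 < a -> potential (vscale a x) = potential x.
Proof.
move=> a0; apply/funext => i; rewrite /potential; congr (_ + _).
by apply: eq_bigr => k _; rewrite wall_sumZ.
Qed.

Lemma potential_equivariant A x : Gam A -> cone x ->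
  potential (matvec A x) = matvec A (potential x).
Proof.
move=> gA xc; apply/funext => i; rewrite /potential.
under eq_bigr => k _ do rewrite wall_sum_equivariant // vaddE mulrDr.
rewrite big_split /= c_coboundary // addrA subrKC matvecE.
rewrite [RHS]matvecE; under [RHS]eq_bigr => j _ do rewrite mulrDr.
rewrite big_split /=; congr (_ + _).
under [RHS]eq_bigr => j _ do rewrite mulr_sumr.
rewrite exchange_big; apply: eq_bigr => k _.
by rewrite matvecE mulr_sumr; apply: eq_bigr => j _; rewrite mulrCA.
Qed.

Lemma mink_potential x y :
  mink (potential x) y = mink u y + \sum_k c k * mink (wall_sum k x) y.
Proof.
under eq_bigr => k _ do rewrite minkE mulr_sumr.
rewrite exchange_big /= !minkE -big_split; apply: eq_bigr => i _ /=.
rewrite /potential; case: ifP => _.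
  rewrite mulrDl opprD mulr_suml -sumrN; congr (_ + _).
  by apply: eq_bigr => k _; rewrite mulrN mulrA.
by rewrite mulrDl mulr_suml; congr (_ + _); apply: eq_bigr => k _; rewrite mulrA.
Qed.

Lemma mink_potential_sub x y z : cone x -> cone y ->
  mink (potential x) z = mink (potential y) z +
  \sum_k c k * \sum_(m \in N k) (Num.sg (mink x m) - Num.sg (mink y m)) * mink m z.
Proof.
move=> xc yc; rewrite !mink_potential -addrA -big_split /=; congr (_ + _).
apply: eq_bigr => k _; rewrite -mulrDr !mink_wall_sum //.
by rewrite -(side_sum_sub _ (fun m => mink m z) xc yc) subrKC.
Qed.

Lemma potential_bounded_on_ball r : exists M, forall x, in_H x -> x ord_max <= r ->
  `|mink (potential x) x| <= M.
Proof.
pose D k := [set m | N k m /\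
  exists y, [/\ in_H y, y ord_max <= r & mink y m = 0]]%classic.
have side2 x m : `|side x m| <= 2.
  rewrite /side; apply: le_trans (ler_normB _ _) _.
  by rewrite !normr_sg; do 2!case: (_ != _) => /=; lra.
pose b i := `|u i| + \sum_k `|c k| * \sum_(m <- fset_set (D k)) 2 * `|m i|.
exists (\sum_i b i * r) => x xH xr; rewrite minkE.
apply: le_trans (ler_norm_sum _ _ _) _; apply: ler_sum => i _.
have -> : `|if i == ord_max then - (potential x i * x i) else potential x i * x i| =
   `|potential x i| * `|x i|.
  by case: ifP => _; rewrite ?normrN normrM.
apply: ler_pM => //; last exact: le_trans (norm_coord_in_H i xH) xr.
apply: le_trans (ler_normD _ _) _; rewrite lerD2l.
apply: le_trans (ler_norm_sum _ _ _) _; apply: ler_sum => k _.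
rewrite normrM ler_wpM2l // /wall_sum (fsum_restrict _ (N_finite k r)); first last.
- move=> m Nm Dm; apply/eqP/negPn/negP => h; apply: Dm; split => //.
  exact: side_neq0_meets h.
- by move=> m [].
apply: le_trans (ler_norm_sum _ _ _) _; apply: ler_sum => m _.
by rewrite normrM ler_wpM2r.
Qed.

Hypothesis Gam_cocompact : acts_cocompactly Gam.

Lemma potential_bound : exists2 M, 0 <= M &
  forall x, cone x -> mink (potential x) x ^+ 2 <= M * - mink x x.
Proof.
have [r hr] := Gam_cocompact; have [M hM] := potential_bounded_on_ball r.
exists (M ^+ 2); rewrite ?sqr_ge0 // => x xc.
have [a a0 aH] := cone_normalize xc; have [xx _] := (in_HP _).1 aH.
have [A [gA [AH /RleP Ar]]] := hr _ aH.
have := hM _ AH Ar.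
rewrite potential_equivariant //; last exact: in_H_cone.
rewrite (Oplus gA).1 potentialZ // minkZr normrM gtr0_norm // => h.
have M0 : 0 <= M by apply: le_trans h; rewrite mulr_ge0 // ltW.
have h2 : (a * `|mink (potential x) x|) ^+ 2 <= M ^+ 2.
  by rewrite ler_pXn2r // nnegrE mulr_ge0 // ltW.
move: h2 xx; rewrite exprMn real_normK ?num_real // minkZl minkZr mulrA -expr2.
have := sqr_ge0 M; have := sqr_ge0 (mink (potential x) x).
case: xc => + _.
move: (mink x x) (mink (potential x) x ^+ 2) (M ^+ 2) (a ^+ 2) => X P Q a2 X0 P0 Q0 h2 hX.
have -> : P = (a2 * P) * - X.
  by rewrite mulrAC mulrN hX opprK mul1r.
by rewrite ler_wpM2r // oppr_ge0 ltW.
Qed.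

Hypothesis d_ge2 : (2 <= d)%N.
Hypothesis N_spacelike : forall k m, N k m -> 0 < mink m m.
Hypothesis N_opp : forall k m, N k m -> N k (vscale (-1) m).
Hypothesis N_disjoint : forall j k m m' x, N j m -> N k m' -> cone x ->
  mink x m = 0 -> mink x m' = 0 -> j = k /\ (m' = m \/ m' = vscale (-1) m).

Lemma cone_along x w s : in_H x -> mink w x = 0 -> s ^+ 2 * mink w w < 1 ->
  cone (vadd x (vscale s w)).
Proof.
move=> xH wx sw; have [xx _] := (in_HP x).1 xH.
apply: (cone_of_mink_lt0 (in_H_cone xH)); rewrite !mink_lin xx ?(minkC x) wx.
  by rewrite mulr0 addr0 add0r mulrA -expr2 addrC subr_lt0.
by rewrite mulr0 addr0 ltrN10.
Qed.

Lemma potential_wall k m x : N k m -> cone x -> mink x m = 0 ->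
  mink (potential x) x = 0.
Proof.
move=> Nm; have q0 := N_spacelike Nm.
suff hH y : in_H y -> mink y m = 0 -> mink (potential y) y = 0.
  move=> xc xm; have [a a0 aH] := cone_normalize xc.
  have := hH _ aH; rewrite minkZl xm mulr0 potentialZ // minkZr.
  by move=> /(_ erefl) /eqP; rewrite mulf_eq0 gt_eqF //= => /eqP.
move=> {}xH ym; have yc := in_H_cone xH.
have [w [wy wm w0]] := plane_tangent d_ge2 xH q0 ym.
have [yy _] := (in_HP y).1 xH.
have [M M0 hM] := potential_bound.
apply: (affine_lightcone_bound (b := mink (potential y) w) w0 M0) => s sw.
have sc := cone_along xH wy sw.
have := hM _ sc; rewrite (mink_potential_sub _ sc yc) big1 ?addr0 => [|j _]; last first.
  rewrite fsbig1 ?mulr0 // => m' Nm'; apply/eqP; rewrite mulf_eq0; apply/orP; left.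
  rewrite subr_eq0 eq_sym; apply/negPn/negP => hs.
  have [l l01 hl] := sgr_neq_segment hs.
  have zc := cone_convex l01 yc sc.
  have zm : mink (vadd (vscale (1 - l) y) (vscale l (vadd y (vscale s w)))) m = 0.
    by rewrite !mink_lin ym wm; ring.
  have zm' : mink (vadd (vscale (1 - l) y) (vscale l (vadd y (vscale s w)))) m' = 0.
    by rewrite minkDl !minkZl.
  case: (N_disjoint Nm Nm' zc zm zm') => _ [] em; move: hs;
    by rewrite em !mink_lin ym wm !mulr0 addr0 ?mulr0 eqxx.
rewrite !minkDr !minkZr !minkDl !minkZl yy (minkC y w) wy.
by rewrite mulr0 addr0 add0r mulrA -expr2 opprD opprK.
Qed.

Lemma first_wall_hit x m t0 :
  in_H x -> mink x m = 0 -> (exists k, N k m) -> 0 < t0 -> t0 ^+ 2 * mink m m < 1 ->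
  (exists k m', N k m' /\ mink (vadd x (vscale t0 m)) m' = 0) ->
  exists t, [/\ 0 < t <= t0,
    exists k m', N k m' /\ mink (vadd x (vscale t m)) m' = 0 &
    forall s k m', 0 < s < t -> N k m' -> mink (vadd x (vscale s m)) m' != 0].
Proof.
move=> xH xm [k Nm] t00 t0q hit0; have xc := in_H_cone xH.
have q0 := N_spacelike Nm.
have ct0 := cone_along xH (etrans (minkC _ _) xm) t0q.
pose T : set R := [set t | 0 < t <= t0 /\
  exists k m', N k m' /\ mink (vadd x (vscale t m)) m' = 0]%classic.
have finT : finite_set T.
  pose S j := (N j `&` [set m' | side (vadd x (vscale t0 m)) m' != 0] `|`
               N j `&` [set m' | side x m' != 0])%classic.
  have finS : finite_set (\bigcup_(j in [set: 'I_n]) S j)%classic.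
    apply: bigcup_finite => // j _.
    by rewrite finite_setU; split; apply: finite_side.
  apply: sub_finite_set (finite_image (fun m' => - mink x m' / mink m m') finS).
  move=> t [/andP[t1 t2] [j [m' [Nm']]]]; rewrite minkDl minkZl => ht.
  have xm'0 : mink x m' != 0.
    apply/eqP => xm'; case: (N_disjoint Nm Nm' xc xm xm') => _ [] em;
      move: ht; rewrite em ?minkZr xm ?mulr0 add0r => /eqP;
      by rewrite !mulf_eq0 ?oppr_eq0 ?oner_eq0 !gt_eqF.
  have mm'0 : mink m m' != 0.
    by apply: contraNneq xm'0 => h; move: ht; rewrite h mulr0 addr0 => ->.
  have et : t = - mink x m' / mink m m'.
    by move/eqP: ht; rewrite addr_eq0 => /eqP ->; rewrite opprK mulfK.
  exists m' => //; exists j => //.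
  apply: contrapT => /not_orP[/not_andP[//|h1] /not_andP[//|h2]].
  move/negP/negPn/eqP: h1; move/negP/negPn/eqP: h2.
  rewrite /side => h2 h1; move: (etrans h1 (esym h2)) => /addIr.
  rewrite minkDl minkZl.
  have -> : mink x m' = - t * mink m m' by move/eqP: ht; rewrite addr_eq0 mulNr => /eqP.
  rewrite -mulrDl !sgrM => /(mulIf _); rewrite sgr_eq0 => /(_ mm'0).
  rewrite sgrN (gtr0_sg t1) addrC => h.
  have : Num.sg (t0 - t) < 0 by rewrite h ltrN10.
  by rewrite sgr_lt0 subr_lt0 ltNge t2.
have [|t [t01 ht] tmin] := finite_set_min finT (t := t0).
  by split; rewrite ?t00 ?lexx.
exists t; split => // s j m' /andP[s0 st] Nm'; apply/eqP => hs.
have : t <= s.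
  apply: tmin; split; last by exists j, m'.
  by rewrite s0 (le_trans (ltW st)) //; case/andP: t01.
by rewrite leNgt st.
Qed.

Lemma potential_ray k m x s : N k m -> in_H x -> mink x m = 0 ->
  0 < s -> s ^+ 2 * mink m m < 1 ->
  (forall t j m', 0 < t < s -> N j m' -> mink (vadd x (vscale t m)) m' != 0) ->
  mink (potential (vadd x (vscale s m))) (vadd x (vscale s m)) =
  s * (mink (potential x) m + 2 * c k * mink m m).
Proof.
move=> Nm xH xm s0 sq nohit; have xc := in_H_cone xH; have q0 := N_spacelike Nm.
have sc := cone_along xH (etrans (minkC _ _) xm) sq.
set y := vadd x (vscale s m) in sc *.
have term0 j m' : N j m' -> ~ (j = k /\ (m' = m \/ m' = vscale (-1) m)) ->
    (Num.sg (mink y m') - Num.sg (mink x m')) * mink m' y = 0.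
  move=> Nm' ne; apply/eqP; rewrite mulf_eq0 subr_eq0 eq_sym.
  apply/orP; have [hs|hs] := boolP (Num.sg (mink x m') == _); first by left.
  right; apply/negPn/negP => ym'0.
  have [l /andP[l0 l1] hl] := sgr_neq_segment hs.
  have hl' : mink (vadd x (vscale (l * s) m)) m' = 0.
    by rewrite -hl /y !mink_lin; ring.
  have [e|ln0] := eqVneq l 0.
    move: hl'; rewrite e mul0r minkDl minkZl mul0r addr0 => xm'.
    by have [] := N_disjoint Nm Nm' xc xm xm' => ekj em; apply: ne.
  have [e|ln1] := eqVneq l 1.
    by move: hl ym'0; rewrite e subrr mul0r mul1r add0r minkC => ->; rewrite eqxx.
  have lpos : 0 < l by rewrite lt_neqAle eq_sym ln0.
  have ls : 0 < l * s < s by rewrite mulr_gt0 //= gtr_pMl // lt_neqAle ln1.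
  by have := nohit _ _ _ ls Nm'; rewrite hl' eqxx.
have mNm : vscale (-1) m <> m.
  move=> /(congr1 (mink m)); rewrite minkZr mulN1r => /eqP.
  by rewrite eq_sym -addr_eq0 -mulr2n mulrn_eq0 /= gt_eqF.
have ym : mink y m = s * mink m m by rewrite /y minkDl minkZl xm add0r.
rewrite (mink_potential_sub _ sc xc) {2}/y minkDr minkZr (potential_wall Nm) // add0r.
rewrite mulrDr; congr (_ + _).
rewrite (bigD1 k) //= [X in _ + X]big1 ?addr0 => [|j jk]; last first.
  rewrite fsbig1 ?mulr0 // => m' Nm'.
  by apply: (term0 j) => // -[/eqP]; rewrite (negbTE jk).
rewrite -(fsbig_widen ([set m] `|` [set vscale (-1) m])%classic (N k)); first last.
- move=> m' [Nm' /not_orP[h1 h2]]; apply: (term0 k) => // -[_ []] //.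
- by move=> m' [->|->] //; exact: N_opp.
rewrite fsbigU0 ?finite_set1 //; last by move=> m' [-> /esym].
rewrite !fsbig_set1 !minkZr minkZl (minkC m y) ym xm mulr0 sgr0 !subr0.
rewrite mulN1r sgrN gtr0_sg ?mulr_gt0 //=; ring.
Qed.

Lemma potential_normal_derivative k m x : N k m -> in_H x -> mink x m = 0 ->
  mink (potential x) m + 2 * c k * mink m m = 0.
Proof.
move=> Nm xH xm; have q0 := N_spacelike Nm; have [xx _] := (in_HP x).1 xH.
have mx : mink m x = 0 by rewrite minkC.
have [[t0 [t00 t0q hit0]]|nohit] := pselect (exists t0, [/\ 0 < t0,
    t0 ^+ 2 * mink m m < 1 &
    exists k m', N k m' /\ mink (vadd x (vscale t0 m)) m' = 0]).
  have [t [/andP[t1 t2] [j [m' [Nm' ht]]] tmin]] :=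
    first_wall_hit xH xm (ex_intro _ _ Nm) t00 t0q hit0.
  have tq : t ^+ 2 * mink m m < 1.
    apply: le_lt_trans t0q; rewrite ler_pM2r // ler_pXn2r // nnegrE ltW //.
  have := potential_ray Nm xH xm t1 tq tmin.
  rewrite (potential_wall Nm' (cone_along xH mx tq) ht) => /esym/eqP.
  by rewrite mulf_eq0 gt_eqF //= => /eqP.
have [M M0 hM] := potential_bound.
apply: (linear_lightcone_bound q0 M0) => s s0 sq.
rewrite -(potential_ray Nm xH xm s0 sq) => [|t j m' /andP[t0 ts] Nm']; last first.
  apply/eqP => ht; apply: nohit; exists t; split => //; last by exists j, m'.
  by apply: lt_trans sq; rewrite ltr_pM2r // ltr_pXn2r // nnegrE ltW.
apply: le_trans (hM _ (cone_along xH mx sq)) _.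
rewrite !mink_lin xx xm mx mulr0 addr0 add0r mulrA -expr2 opprD opprK //.
Qed.

Lemma wall_weight0 k m : N k m -> c k = 0.
Proof.
move=> Nm; have q0 := N_spacelike Nm.
have [x [xH xm]] := plane_nonempty q0.
have h1 := potential_normal_derivative Nm xH xm.
have xm' : mink x (vscale (-1) m) = 0 by rewrite minkZr xm mulr0.
have h2 := potential_normal_derivative (N_opp Nm) xH xm'.
move: h2; rewrite !minkZr !minkZl => h2.
have : c k * mink m m = 0 by lra.
by move/eqP; rewrite mulf_eq0 (gt_eqF q0) orbF => /eqP.
Qed.

End Walls.

Section Translates.
Variables (d : nat) (Gam : Mat d -> Prop).
Hypothesis Gam_group : is_subgroup_Oplus Gam.
Implicit Types (v x y : Vec d) (A B : Mat d).

Let Oplus A : Gam A -> in_Oplus A.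
Proof. by case: Gam_group => _ [_ [_]]; apply. Qed.

Lemma in_translateP A v y : Gam A -> in_translate A v y <-> onP (matvec A v) y.
Proof.
move=> gA; have [_ [_ [inv _]]] := Gam_group; have [B [gB [AB BA]]] := inv A gA.
split=> [[x [[xH xv] ->]]|[yH yv]].
  by split; [exact: (Oplus gA).2|rewrite (Oplus gA).1].
exists (matvec B y); rewrite -matvecM AB matvec1; split=> //.
split; first exact: (Oplus gB).2.
by rewrite -((Oplus gA).1 _ v) -matvecM AB matvec1.
Qed.

Lemma same_translates_normal A B v : Gam A -> Gam B -> 0 < mink v v ->
  same_translates A B v ->
  matvec B v = matvec A v \/ matvec B v = vscale (-1) (matvec A v).
Proof.
move=> gA gB v0 AB; apply: same_plane_normal; rewrite ?(Oplus gA).1 ?(Oplus gB).1 //.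
by move=> y /(in_translateP _ _ gA) /AB /(in_translateP _ _ gB) [].
Qed.

Definition normals v : set (Vec d) :=
  [set m | exists2 A, Gam A & m = matvec A v \/ m = vscale (-1) (matvec A v)]%classic.

Lemma vscaleN1K v : vscale (-1) (vscale (-1) v) = v.
Proof. by apply/funext => i; rewrite !vscaleE !mulN1r opprK. Qed.

Lemma normals_base v : normals v v.
Proof. by exists Defs.idm; [case: Gam_group|left; rewrite matvec1]. Qed.

Lemma normals_opp v m : normals v m -> normals v (vscale (-1) m).
Proof. by case=> A gA [->|->]; exists A; rewrite ?vscaleN1K; auto. Qed.

Lemma normals_inv v A m : Gam A -> normals v m -> normals v (matvec A m).
Proof.
move=> gA [B gB hm]; exists (matmul A B).
  by case: Gam_group => _ [mul _]; exact: mul.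
by rewrite matvecM; case: hm => ->; rewrite ?matvecZ; auto.
Qed.

Lemma normals_spacelike v m : 0 < mink v v -> normals v m -> 0 < mink m m.
Proof.
by move=> v0 [A gA [->|->]]; rewrite ?minkZl ?minkZr ?mulN1r ?opprK (Oplus gA).1.
Qed.

Lemma normals_finite v r : embedded_tg_hypersurface Gam v ->
  finite_set [set m | normals v m /\
    exists y, [/\ in_H y, y ord_max <= r & mink y m = 0]].
Proof.
move=> [/RltP v0 [_ /(_ r)[l [lG hl]]]].
pose s := map (fun A => matvec A v) l ++ map (fun A => vscale (-1) (matvec A v)) l.
apply: (@sub_finite_set _ _ [set` s]%classic); last exact: finite_seq.
move=> m [[A gA hm] [y [yH yr ym]]].
have yA : mink y (matvec A v) = 0.
  case: hm ym => -> //; rewrite minkZr => /eqP.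
  by rewrite mulf_eq0 oppr_eq0 oner_eq0 => /eqP.
have [|B [Bl AB]] := hl A gA.
  by exists y; split; [exact/in_translateP|split=> //; exact/RleP].
have eqB := same_translates_normal gA (lG B Bl) v0 AB.
have inB (f : Mat d -> Vec d) : f B \in map f l.
  by elim: l Bl {hl lG s} => //= a l ih [->|/ih h]; rewrite inE ?eqxx // h orbT.
have [->|->] : m = matvec B v \/ m = vscale (-1) (matvec B v).
  by case: hm eqB => -> [] ->; rewrite ?vscaleN1K; auto.
- by rewrite /= mem_cat (inB (fun A => matvec A v)).
- by rewrite /= mem_cat (inB (fun A => vscale (-1) (matvec A v))) orbT.
Qed.

Lemma normals_meet v w m m' x :
  embedded_tg_hypersurface Gam v -> v = w \/ disjoint_in_quotient Gam v w ->
  normals v m -> normals w m' -> cone x -> mink x m = 0 -> mink x m' = 0 ->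
  v = w /\ (m' = m \/ m' = vscale (-1) m).
Proof.
move=> [/RltP v0 [emb _]] vw [A gA hm] [B gB hm'] xc.
have [a a0 aH] := cone_normalize xc.
have norm z z' : z = z' \/ z = vscale (-1) z' -> mink x z = 0 -> mink (vscale a x) z' = 0.
  by rewrite minkZl => -[] ->; rewrite ?minkZr ?mulN1r => /eqP;
    rewrite ?oppr_eq0 => /eqP ->; rewrite mulr0.
move=> /(norm _ _ hm) xA /(norm _ _ hm') xB.
move: (vscale a x) aH xA xB => {norm xc a0}y yH yA yB.
have [_ [mul [inv _]]] := Gam_group; have [C [gC [BC CB]]] := inv B gB.
have gCA : Gam (matmul C A) by exact: mul.
have hit : exists z, in_translate (matmul C A) v z /\ onP w z.
  exists (matvec C y); split.
    apply/in_translateP => //; rewrite matvecM; split; first exact: (Oplus gC).2.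
    by rewrite (Oplus gC).1.
  split; first exact: (Oplus gC).2.
  by rewrite -((Oplus gB).1 _ w) -matvecM BC matvec1.
case: vw => [evw|/(_ _ gCA) /(_ hit) //]; split=> //; subst w.
case: (emb _ gCA) => [same|/(_ hit) //].
have := same_translates_normal gCA (proj1 Gam_group) v0 same.
rewrite matvec1 matvecM => hv.
have {hv} : matvec B v = matvec A v \/ matvec B v = vscale (-1) (matvec A v).
  by case: hv => /(congr1 (matvec B)); rewrite ?matvecZ -matvecM BC matvec1; auto.
by case: hm hm' => -> [] -> [] ->; rewrite ?vscaleN1K; auto.
Qed.

End Translates.

Theorem theorem3p3 (d : nat) (hd : (2 <= d)%N) (Gam : Mat d -> Prop)
  (hGam : cocompact_torsionfree_lattice Gam)
  (n : nat) (v : 'I_n -> Vec d)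
  (hemb : forall k, embedded_tg_hypersurface Gam (v k))
  (hdisj : forall i j, i != j -> disjoint_in_quotient Gam (v i) (v j)) :
  dimH1_ge Gam n.
Proof.
case: hGam => grp [_ [_ [cocpt _]]].
have v0 k : 0 < mink (v k) (v k) by case: (hemb k) => /RltP.
pose N k := normals Gam (v k).
have Ninv k A m : Gam A -> N k m -> N k (matvec A m) by exact: normals_inv.
have Nfin k r := normals_finite grp r (hemb k).
exists (fun k A => wall_sum N k (matvec A (origin d))); split.
  by move=> k; exact: wall_sum_cocycle.
move=> c [u hu] k.
apply: (wall_weight0 grp Ninv Nfin (u := u) _ cocpt hd _ _ _ (normals_base grp (v k))).
- by move=> A i gA; have /(congr1 (fun f => f i)) := hu A gA.
- by move=> j m; exact: normals_spacelike.
- by move=> j m; exact: normals_opp.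
- move=> i j m m' x Nm Nm' xc xm xm'.
  have vij : v i = v j \/ disjoint_in_quotient Gam (v i) (v j).
    by have [->|/hdisj] := eqVneq i j; auto.
  have [evij mm'] := normals_meet grp (hemb i) vij Nm Nm' xc xm xm'.
  split=> //; apply/eqP; apply: contrapT => /negP/hdisj/(_ _ (proj1 grp)) [].
  have [y yP] := plane_nonempty (v0 i).
  exists y; split; last by rewrite -evij.
  by apply/(in_translateP grp _ _ (proj1 grp)); rewrite matvec1.
Qed.
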